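(* There exist a 2-generator group $G$, a full order relation on $G$, and an embedding (injective homomorphism) $\Phi:\mathbb{Q}\to G$ of the additive group of rational numbers $\mathbb{Q}$ (fully ordered by its natural order) into $G$ such that $\Phi$ is order-preserving and subnormal. Moreover, the group $G$ can be chosen to be a solvable group of length $3$.
   Context: A group $G$ is fully ordered if a linear (total) order relation $<$ is defined on $G$ such that for all $g_1,g_2\in G$, $g_1<g_2$ implies $g_1x<g_2x$ and $xg_1<xg_2$ for every $x\in G$; such a relation $<$ is called a full order relation on $G$. An embedding $\varphi$ of a fully ordered group $H$ into a fully ordered group $G$ is order-preserving if for all $h_1,h_2\in H$: $h_1<h_2$ in $H$ if and only if $\varphi(h_1)<\varphi(h_2)$ in $G$. An embedding $\varphi:H\to G$ is subnormal if $\varphi(H)$ is a subnormal subgroup of $G$, i.e. there is a finite series of subgroups $\varphi(H)=G_0\le G_1\le\dots\le G_n=G$ with $G_{i-1}$ normal in $G_i$ for every $i=1,\dots,n$. A 2-generator group is a group generated by two elements. The length of a solvable group is its derived length. *)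

(* Defs.v *)
From mathcomp Require Import all_boot all_order all_algebra.
From mathcomp Require Import boolp classical_sets.

Set Implicit Arguments.
Unset Strict Implicit.
Unset Printing Implicit Defensive.

Local Open Scope classical_set_scope.
Local Open Scope group_scope.

Record full_order (G : groupType) (lt : rel G) : Prop := FullOrder {
  full_order_irr : irreflexive lt;
  full_order_trans : transitive lt;
  full_order_total : forall x y, x != y -> lt x y || lt y x;
  full_order_mulr : forall g1 g2 x, lt g1 g2 -> lt (g1 * x) (g2 * x);
  full_order_mull : forall g1 g2 x, lt g1 g2 -> lt (x * g1) (x * g2)
}.

Definition is_subgroup (G : groupType) (H : set G) : Prop :=
  group_closed [in H].

Definition is_normal (G : groupType) (H K : set G) : Prop :=
  H `<=` K /\ forall h k, H h -> K k -> H (h ^ k).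

Definition is_subnormal (G : groupType) (H : set G) : Prop :=
  exists (n : nat) (S : nat -> set G),
    [/\ S 0%N = H, S n = setT,
        forall i, (i <= n)%N -> is_subgroup (S i)
      & forall i, (i < n)%N -> is_normal (S i) (S i.+1)].

Definition generated (G : groupType) (A : set G) : set G :=
  smallest (@is_subgroup G) A.

(* The two generators are not required to be distinct. *)
Definition two_generator (G : groupType) : Prop :=
  exists a b : G, generated [set a; b] = setT.

Definition commutator_subgroup (G : groupType) (H : set G) : set G :=
  generated [set [~ x, y] | x in H & y in H].

Definition derived_subgroup (G : groupType) (n : nat) : set G :=
  iter n (@commutator_subgroup G) setT.

Arguments derived_subgroup : clear implicits.

Definition solvable_of_length (G : groupType) (n : nat) : Prop :=
  derived_subgroup G n = [set 1] /\
  forall m, (m < n)%N -> derived_subgroup G m <> [set 1].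

(* Main.v *)
(* P. Hall's construction.  Let V be the free abelian group on (e_i), i in Z,
   with the bilinear form beta(e_i, e_j) = s(j - i), where s(n) = 1/n! for
   n >= 0 and s(n) = 0 for n < 0.  The central extension N of V by Q with
   cocycle beta is nilpotent of class 2, and the shift e_i |-> e_(i+1)
   preserves beta, so an infinite cyclic group <t> acts on N; take G = N : <t>.
   - Since [e_0, e_n] = 1/n!, the elements e_0 and t generate G.
   - Q is central, hence normal, in G.
   - G is ordered lexicographically: first by the exponent of t, then by the
     first nonzero coefficient of the V-component (which the shift respects),
     and last by the Q-component.
   - G' lies in N and N' in Q, so G''' = 1; and G'' is not trivial because
     [e_(-1) - e_0, e_0 - e_1] = 2 s(1) - s(2) = 3/2. *)
Require Import Defs.
From HB Require Import structures.
From mathcomp Require Import all_boot all_order all_algebra.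
From mathcomp Require Import finmap.
From mathcomp Require Import boolp classical_sets functions cardinality fsbigop.
From mathcomp Require Import ring.

Set Implicit Arguments.
Unset Strict Implicit.
Unset Printing Implicit Defensive.

Import Order.TTheory GRing.Theory Num.Theory.

(** * Positive cones, commutators and generated subgroups in an arbitrary group *)

Section Groups.
Local Open Scope group_scope.
Local Open Scope classical_set_scope.

(** Left translation cancels in [x^-1 * y], while right translation by [x] conjugates it by [x];
    hence invariance of the cone under conjugation gives a two-sided order. *)
Lemma full_order_cone (G : groupType) (pos : pred G) :
  ~~ pos 1 ->
  (forall x y, pos x -> pos y -> pos (x * y)) ->
  (forall x y, pos x -> pos (x ^ y)) ->
  (forall x, x != 1 -> pos x || pos x^-1) ->
  full_order (fun x y => pos (x^-1 * y)).
Proof.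
move=> pos1 posM posJ posV; split.
- by move=> x; rewrite mulVg; apply: negbTE.
- by move=> y x z xy yz; rewrite -[x^-1](mulgK y) -mulgA posM.
- move=> x y; rewrite eq_sym => xy.
  rewrite -[X in _ || pos X]invgK invgM invgK; apply: posV.
  by apply: contra xy => /eqP xy; rewrite -[y](mulVKg x) xy mulg1.
- move=> g1 g2 x /posJ-/(_ x).
  by rewrite /conjg invgM !mulgA.
- by move=> g1 g2 x; rewrite invgM mulgA mulgVK.
Qed.

Lemma commg_eq (G : groupType) (x y z : G) : x * y = y * x * z -> [~ x, y] = z.
Proof. by rewrite commgC => /mulgI. Qed.

Lemma is_subgroupP (G : groupType) (H : set G) :
  is_subgroup H <-> H 1 /\ (forall x y, H x -> H y -> H (x * y^-1)).
Proof.
split=> -[H1 HV].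
  by split=> [|x y /mem_set Hx /mem_set Hy]; apply/set_mem => //; apply: HV.
by split=> [|x y /set_mem Hx /set_mem Hy]; apply/mem_set => //; apply: HV.
Qed.

Lemma is_subgroup_generated (G : groupType) (A : set G) : is_subgroup (generated A).
Proof.
apply/is_subgroupP; split=> [H [/is_subgroupP[] //]|x y Ax Ay H HA].
by have [/is_subgroupP[_ HV] _] := HA; apply: HV; [exact: Ax | exact: Ay].
Qed.

Section Generation.
Variables (G : groupType) (H : set G).
Hypothesis subgH : is_subgroup H.

Lemma subgroup1 : H 1. Proof. by have /is_subgroupP[] := subgH. Qed.

Lemma subgroupV x : H x -> H x^-1.
Proof.
by have /is_subgroupP[H1 HV] := subgH => Hx; rewrite -[x^-1]mul1g; apply: HV.
Qed.

Lemma subgroupM x y : H x -> H y -> H (x * y).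
Proof.
have /is_subgroupP[H1 HV] := subgH => Hx Hy.
by rewrite -[y]invgK; apply: HV => //; apply: subgroupV.
Qed.

Lemma subgroupR x y : H x -> H y -> H [~ x, y].
Proof.
by move=> Hx Hy; rewrite /commg /conjg; do !apply: subgroupM => //; apply: subgroupV.
Qed.

End Generation.

Lemma mem_commutator (G : groupType) (H : set G) x y :
  H x -> H y -> commutator_subgroup H [~ x, y].
Proof. by move=> Hx Hy K [_]; apply; exists x => //; exists y. Qed.

Lemma commutator_subgroup_sub (G : groupType) (H K : set G) :
  is_subgroup K -> (forall x y, H x -> H y -> K [~ x, y]) ->
  commutator_subgroup H `<=` K.
Proof.
by move=> subgK HK; apply: smallest_sub => // _ [x Hx [y Hy <-]]; apply: HK.
Qed.

End Groups.

Local Open Scope ring_scope.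
Local Open Scope classical_set_scope.

(** An arbitrary predicate is allowed so that [P] can be membership of [tr k], [cen q] or [vec u] in
    a subgroup; [vec] is not even a homomorphism. *)
Lemma mulz_closed (V : zmodType) (P : V -> Prop) :
  P 0 -> (forall a b, P a -> P b -> P (a + b)) -> (forall a, P a -> P (- a)) ->
  forall a (n : int), P a -> P (a *~ n).
Proof.
move=> P0 PD PN a n Pa.
have Pn m : P (a *+ m).
  by elim: m => [|m IH]; rewrite ?mulr0n ?mulrS //; apply: PD.
case: n => m; first by rewrite -pmulrn.
by rewrite NegzE mulrNz; apply: PN; rewrite -pmulrn.
Qed.

(** * The free abelian group V, as finitely supported functions on the integers *)

Definition fsupp : {pred int -> int} :=
  [pred u | `[< finite_set [set i | u i != 0] >]].

Lemma fsupp_zmod_closed : zmod_closed fsupp.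
Proof.
split.
  by apply/asboolP/(sub_finite_set _ (finite_set0 int)) => i /negP[]; exact: eqxx.
move=> u v /asboolP fu /asboolP fv; apply/asboolP.
have fuv : finite_set ([set i | u i != 0] `|` [set i | v i != 0]).
  by rewrite finite_setU.
apply: sub_finite_set fuv => i /= h.
case: (eqVneq (u i) 0) => [ui|]; [right | by left].
by apply: contraNN h => /eqP vi; rewrite -[_ i]/(u i - v i) ui vi subr0.
Qed.

HB.instance Definition _ :=
  GRing.isZmodClosed.Build (int -> int) fsupp fsupp_zmod_closed.

Record lattice := Lattice { coef :> int -> int; coefP : coef \in fsupp }.

HB.instance Definition _ := [isSub for coef].
HB.instance Definition _ := [Choice of lattice by <:].
HB.instance Definition _ := [SubChoice_isSubZmodule of lattice by <:].

Implicit Types (u v w : lattice) (i j k : int) (f g : int -> rat).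

Definition supp u : set int := [set i | u i != 0].

Lemma finite_supp u : finite_set (supp u).
Proof. by have /asboolP := coefP u. Qed.

Lemma latticeP u v : u =1 v <-> u = v.
Proof. by split=> [uv|-> //]; apply/val_inj/funext. Qed.

Lemma coefD u v i : (u + v) i = u i + v i. Proof. by []. Qed.
Lemma coefN u i : (- u) i = - u i. Proof. by []. Qed.
Lemma coef0 i : (0 : lattice) i = 0. Proof. by []. Qed.

Definition coef_at i u := u i.

Lemma coef_at_is_zmod_morphism i : zmod_morphism (coef_at i).
Proof. by []. Qed.

HB.instance Definition _ i :=
  GRing.isZmodMorphism.Build lattice int (coef_at i)
    (@coef_at_is_zmod_morphism i).

Lemma delta_fsupp i : (fun j => (j == i)%:Z) \in fsupp.
Proof.
apply/asboolP/(sub_finite_set _ (finite_set1 i)) => j /=.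
by case: (j =P i).
Qed.

(** The basis element e_i of V. *)
Definition delta i := Lattice (delta_fsupp i).

Lemma shift_fsupp k u : (fun i => u (i - k)) \in fsupp.
Proof.
apply/asboolP/(sub_finite_set _ (finite_image (fun i => i + k) (finite_supp u))).
by move=> i /= ui; exists (i - k); rewrite // subrK.
Qed.

Definition shift k u := Lattice (shift_fsupp k u).

Lemma shiftE k u i : shift k u i = u (i - k). Proof. by []. Qed.

Lemma shiftD k : {morph shift k : u v / u + v}.
Proof. by move=> u v; apply/latticeP. Qed.

Lemma shiftN k : {morph shift k : u / - u}.
Proof. by move=> u; apply/latticeP. Qed.

Lemma shift0 k : shift k 0 = 0.
Proof. by apply/latticeP. Qed.

Lemma shift0l u : shift 0 u = u.
Proof. by apply/latticeP => i; rewrite shiftE subr0. Qed.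

Lemma shift_shift k l u : shift k (shift l u) = shift (k + l) u.
Proof. by apply/latticeP => i; rewrite !shiftE opprD addrA. Qed.

Lemma shift_delta k i : shift k (delta i) = delta (i + k).
Proof. by apply/latticeP => j; rewrite shiftE /= subr_eq. Qed.

Lemma lattice_sum u : u = \sum_(i <- fset_set (supp u)) delta i *~ u i.
Proof.
apply/latticeP => j; rewrite -[RHS]/(coef_at j _) raddf_sum /=.
under eq_bigr => i _ do rewrite raddfMz /coef_at /=.
(* Off the support every term vanishes at [j]; on it only the term of index [j] survives. *)
have [uj|uj] := eqVneq (u j) 0.
  rewrite big1_seq ?uj // => i /= iu.
  have [ij|_] := eqVneq j i; last by rewrite mul0rz.
  by rewrite -ij uj mulr0z.
rewrite (big_fsetD1 j) /=; last by rewrite in_fset_set ?inE//; exact: finite_supp.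
rewrite eqxx big1_seq ?addr0 ?intz // => i /=.
rewrite !inE eq_sym => /andP[/negbTE-> _]; exact: mul0rz.
Qed.

(** * Linear extension from the basis *)

(** The value at [u] of the additive map V -> Q that sends each e_i to [f i]. *)
Definition pair u f : rat := \sum_(i \in supp u) (u i)%:~R * f i.

(** Brings pairings of vectors with different supports to one common index set, as additivity in [u]
    requires. *)
Lemma pair_widen (A : set int) u f :
  supp u `<=` A -> pair u f = \sum_(i \in A) (u i)%:~R * f i.
Proof.
move=> uA; apply: fsbig_widen => // i [_ /= /negP]; rewrite negbK => /eqP ->.
by rewrite mul0r.
Qed.

Lemma pairDl u v f : pair (u + v) f = pair u f + pair v f.
Proof.
have fin : finite_set (supp u `|` supp v).
  by rewrite finite_setU; split; apply: finite_supp.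
rewrite !(@pair_widen (supp u `|` supp v)).
- rewrite -fsbig_split //; apply: eq_fsbigr => i _.
  by rewrite coefD intrD mulrDl.
- by move=> i; right.
- by move=> i; left.
- move=> i; rewrite /supp /mkset coefD => uv.
  have [ui|] := eqVneq (u i) 0; [right | by left].
  by apply: contraNN uv => /eqP vi; rewrite ui vi.
Qed.

Lemma pairDr u f g : pair u (f \+ g) = pair u f + pair u g.
Proof.
rewrite -fsbig_split; last exact: finite_supp.
by apply: eq_fsbigr => i _; rewrite mulrDr.
Qed.

Lemma eq_pair u f g : f =1 g -> pair u f = pair u g.
Proof. by move=> fg; congr pair; apply/funext. Qed.

Lemma pair_delta i f : pair (delta i) f = f i.
Proof.
rewrite (@pair_widen [set i]) ?fsbig_set1 /= ?eqxx ?mul1r//.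
by move=> j; rewrite /supp /=; case: (j =P i).
Qed.

Lemma pair_shift k u f : pair (shift k u) f = pair u (fun i => f (i + k)).
Proof.
rewrite /pair (@reindex_fsbig _ _ _ _ _ (fun i => i + k) (supp u)).
  by apply: eq_fsbigr => i _; rewrite shiftE addrK.
split=> [i|x y _ _|i]; first by rewrite /supp /= addrK.
  exact: addIr.
by rewrite /supp /= => ui; exists (i - k); rewrite ?subrK.
Qed.

(** * The lexicographic positive cone of V *)

Lemma neq0_min_coef u : u != 0 -> exists i, u i != 0 /\ forall j, j < i -> u j = 0.
Proof.
move=> u0; have suppP j : (j \in fset_set (supp u)) = (u j != 0).
  rewrite in_fset_set; last exact: finite_supp.
  by apply/idP/idP; rewrite inE.
have [i0 ui0] : exists i, u i != 0.
  apply: contrapT => /forallNP h; case/eqP: u0.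
  by apply/latticeP => i; apply/eqP/negPn/negP/h.
rewrite -suppP in ui0.
(* The minimum is taken over the support seen as a finite type, which [i0] shows to be inhabited. *)
have [i _ imin] := @Order.TotalTheory.arg_minP _ _ (fset_set (supp u))
  (FSetSub ui0) xpredT val isT.
exists (val i); split=> [|j]; first by rewrite -suppP fsvalP.
move=> ji; apply/eqP; apply: contraTT ji => uj; rewrite -suppP in uj.
by rewrite -leNgt (imin (FSetSub uj)).
Qed.

Definition lexpos u := `[< exists i, 0 < u i /\ forall j, j < i -> u j = 0 >].

Lemma lexpos0 : ~~ lexpos 0.
Proof. by apply/asboolPn => -[i [+ _]]; rewrite coef0 ltxx. Qed.

(** The sum has its leading index at the smaller of the two; if they coincide, two positive
    coefficients cannot cancel. *)
Lemma lexposD u v : lexpos u -> lexpos v -> lexpos (u + v).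
Proof.
move=> /asboolP[i [ui i_min]] /asboolP[j [vj j_min]]; apply/asboolP.
exists (Order.min i j); split=> [|k].
  rewrite coefD; case: (ltgtP i j) => ij.
  - by rewrite (j_min i) // addr0.
  - by rewrite (i_min j) // add0r.
  - by rewrite -ij in vj *; rewrite addr_gt0.
by rewrite lt_min coefD => /andP[/i_min -> /j_min ->].
Qed.

Lemma lexpos_shift k u : lexpos u -> lexpos (shift k u).
Proof.
move=> /asboolP[i [ui i_min]]; apply/asboolP; exists (i + k).
by split=> [|j]; rewrite shiftE ?addrK // -ltrBlDr => /i_min.
Qed.

Lemma lexposVN u : u != 0 -> lexpos u || lexpos (- u).
Proof.
move=> /neq0_min_coef[i [ui i_min]].
have [ui_gt0|ui_le0] := ltP 0 (u i); apply/orP; [left|right]; apply/asboolP.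
  by exists i.
exists i; split=> [|j /i_min uj]; last by rewrite coefN uj oppr0.
by rewrite coefN oppr_gt0 lt_neqAle ui.
Qed.

(** * The bilinear form on V *)

(** The function s. Its vanishing at negative integers makes [beta] non-symmetric, which is what
    produces nontrivial commutators. *)
Definition invfact (n : int) : rat := if 0 <= n then (`|n|%N)`!%:R^-1 else 0.

Definition beta u v := pair u (fun i => pair v (fun j => invfact (j - i))).

Lemma betaDl u v w : beta (u + v) w = beta u w + beta v w.
Proof. exact: pairDl. Qed.

Lemma betaDr u v w : beta u (v + w) = beta u v + beta u w.
Proof. by rewrite -pairDr; apply: eq_pair => i; rewrite pairDl. Qed.

Lemma beta0l u : beta 0 u = 0.
Proof. by apply: (addrI (beta 0 u)); rewrite -betaDl !addr0. Qed.

Lemma beta0r u : beta u 0 = 0.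
Proof. by apply: (addrI (beta u 0)); rewrite -betaDr !addr0. Qed.

Lemma betaNl u v : beta (- u) v = - beta u v.
Proof. by apply: (addrI (beta u v)); rewrite -betaDl !subrr beta0l. Qed.

Lemma betaNr u v : beta u (- v) = - beta u v.
Proof. by apply: (addrI (beta u v)); rewrite -betaDr !subrr beta0r. Qed.

(** The form on basis elements depends only on the difference of indices. Hence t acts on N by
    automorphisms, and [hall_mul] is associative. *)
Lemma beta_shift k u v : beta (shift k u) (shift k v) = beta u v.
Proof.
rewrite /beta pair_shift; apply: eq_pair => i; rewrite pair_shift.
by apply: eq_pair => j; rewrite opprD addrACA subrr addr0.
Qed.

Lemma beta_delta i j : beta (delta i) (delta j) = invfact (j - i).
Proof. by rewrite /beta !pair_delta. Qed.

(* The triple (q, u, k) stands for q * u * t ^ k with q in Q and u in V. *)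
Definition hall : Type := (rat * lattice * int)%type.
HB.instance Definition _ := Choice.on hall.

(** * The group G on triples, and its commutators *)

(** Moving t^k to the right past the second V-component shifts that component by k; multiplying the
    two V-components then contributes the cocycle [beta]. *)
Definition hall_mul (x y : hall) : hall :=
  (x.1.1 + y.1.1 + beta x.1.2 (shift x.2 y.1.2), x.1.2 + shift x.2 y.1.2,
   x.2 + y.2).

Definition hall_one : hall := (0, 0, 0).

(** The term [beta u u] compensates the cocycle: [vec u * vec (- u)] is [cen (- beta u u)]. *)
Definition hall_inv (x : hall) : hall :=
  (beta x.1.2 x.1.2 - x.1.1, - shift (- x.2) x.1.2, - x.2).

Lemma hall_mulA : associative hall_mul.
Proof.
move=> [[q u] k] [[r v] l] [[s w] m]; rewrite /hall_mul /=.
rewrite -!shift_shift !shiftD !betaDl !betaDr beta_shift !addrA.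
by congr (_, _, _); ring.
Qed.

Lemma hall_mul1g : left_id hall_one hall_mul.
Proof.
by move=> [[q u] k]; rewrite /hall_mul /= beta0l shift0l !add0r addr0.
Qed.

Lemma hall_mulg1 : right_id hall_one hall_mul.
Proof.
by move=> [[q u] k]; rewrite /hall_mul /= shift0 beta0r !addr0.
Qed.

Lemma hall_mulVg : left_inverse hall_one hall_inv hall_mul.
Proof.
move=> [[q u] k]; rewrite /hall_mul /= betaNl beta_shift !addNr.
by congr (_, _, _); ring.
Qed.

Lemma hall_mulgV : right_inverse hall_one hall_inv hall_mul.
Proof.
move=> [[q u] k]; rewrite /hall_mul /= shiftN betaNr shift_shift subrr shift0l.
by rewrite !subrr; congr (_, _, _); ring.
Qed.

HB.instance Definition _ := isGroup.Build hall
  hall_mulA hall_mul1g hall_mulg1 hall_mulVg hall_mulgV.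

Local Open Scope group_scope.
Implicit Types x y z : hall.

Lemma hall_mulE x y : x * y = hall_mul x y. Proof. by []. Qed.
Lemma hall_invE x : x^-1 = hall_inv x. Proof. by []. Qed.

Definition cen (q : rat) : hall := (q, 0%R, 0%R).
Definition vec u : hall := (0%R, u, 0%R).
Definition tr k : hall := (0%R, 0%R, k).

Lemma cenD : {morph cen : q r / (q + r)%R >-> q * r}.
Proof. by move=> q r; rewrite hall_mulE /hall_mul /= shift0 beta0r !addr0. Qed.

Lemma cenN : {morph cen : q / (- q)%R >-> q^-1}.
Proof. by move=> q; rewrite hall_invE /hall_inv /= shift0 beta0r oppr0 sub0r. Qed.

Lemma trD : {morph tr : k l / (k + l)%R >-> k * l}.
Proof. by move=> k l; rewrite hall_mulE /hall_mul /= shift0 beta0r !addr0. Qed.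

Lemma trN : {morph tr : k / (- k)%R >-> k^-1}.
Proof. by move=> k; rewrite hall_invE /hall_inv /= shift0 beta0r subr0 oppr0. Qed.

Lemma vecD u v : vec (u + v)%R = vec u * vec v * cen (- beta u v)%R.
Proof.
rewrite !hall_mulE /hall_mul /= !shift0l !beta0r !addr0 !add0r.
by congr (_, _, _); ring.
Qed.

Lemma vecN u : vec (- u)%R = (vec u)^-1 * cen (- beta u u)%R.
Proof.
rewrite hall_mulE hall_invE /hall_mul /= shift0 beta0r oppr0 shift0l !addr0.
by congr (_, _, _); ring.
Qed.

Lemma vec_shift u k : vec (shift k u) = tr k * vec u * tr (- k)%R.
Proof.
by rewrite !hall_mulE /hall_mul /= !shift0 !beta0r beta0l !addr0 !add0r subrr.
Qed.

Lemma hall_decomp q u k : (q, u, k) = cen q * vec u * tr k.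
Proof.
by rewrite !hall_mulE /hall_mul /= !shift0 !shift0l !beta0r beta0l !addr0 !add0r.
Qed.

Lemma cen_commute q x : commute (cen q) x.
Proof.
case: x => [[r v] k].
rewrite /commute !hall_mulE /hall_mul /= shift0 shift0l beta0l beta0r.
by rewrite !addr0 !add0r addrC.
Qed.

(** Inside N the two products [x * y] and [y * x] differ only in the order of the arguments of
    [beta]. *)
Lemma commg_ker x y : x.2 = 0%R -> y.2 = 0%R ->
  [~ x, y] = cen (beta x.1.2 y.1.2 - beta y.1.2 x.1.2)%R.
Proof.
case: x y => [[q u] k] [[r v] l] /= -> ->; apply: commg_eq.
rewrite !hall_mulE /hall_mul /= !shift0l !beta0r !addr0.
by congr (_, _, _); [ring | rewrite addrC].
Qed.

(** The exponent of t is a homomorphism to an abelian group. *)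
Lemma commg_snd x y : [~ x, y].2 = 0%R.
Proof. by rewrite /commg /conjg !hall_mulE !hall_invE /=; ring. Qed.

Lemma commg_vec_tr i :
  [~ vec (delta i), tr 1%R].1.2 = (delta (i - 1) - delta i)%R.
Proof.
rewrite /commg /conjg !hall_mulE !hall_invE /=.
rewrite !shift0 oppr0 !shift0l !oppr0 add0r addr0.
by rewrite addrC shift_delta.
Qed.

(** * The full order on G *)

Definition hall_pos x :=
  (0 < x.2)%R || (x.2 == 0%R) && (lexpos x.1.2 || (x.1.2 == 0%R) && (0 < x.1.1)%R).

Definition hall_lt x y := hall_pos (x^-1 * y).

Lemma hall_posP x : reflect
  [\/ (0 < x.2)%R, x.2 = 0%R /\ lexpos x.1.2
    | [/\ x.2 = 0%R, x.1.2 = 0%R & (0 < x.1.1)%R]] (hall_pos x).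
Proof.
apply: (iffP orP) => [[|/andP[/eqP x2 /orP[|/andP[/eqP x12]]]]|[|[-> ->]|[-> -> ->]]].
- by constructor 1.
- by constructor 2.
- by constructor 3.
- by left.
- by right; rewrite eqxx.
- by right; rewrite !eqxx orbT.
Qed.

Lemma hall_posM x y : hall_pos x -> hall_pos y -> hall_pos (x * y).
Proof.
case: x y => [[q u] k] [[r v] l] /hall_posP /= px /hall_posP /= py.
apply/hall_posP; rewrite hall_mulE /hall_mul /=.
case: px => [k_gt0|[-> pu]|[-> -> q_gt0]];
  case: py => [l_gt0|[-> pv]|[-> -> r_gt0]];
  rewrite ?shift0l ?shift0 ?addr0 ?add0r ?beta0l ?beta0r ?addr0;
  (* This closes the five cases, out of nine, in which some factor has a positive exponent of t. *)
  try by constructor 1; rewrite ?addr_gt0.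
- by constructor 2; rewrite lexposD.
- by constructor 2.
- by constructor 2.
- by constructor 3; rewrite addr_gt0.
Qed.

(** Conjugation preserves the exponent of t; if that is zero it merely shifts the V-component, and
    it fixes central elements. *)
Lemma hall_posJ x y : hall_pos x -> hall_pos (x ^ y).
Proof.
case: y => [[r v] l] /hall_posP; case: x => [[q u] k] /= px.
apply/hall_posP; case: px => [k_gt0|[-> pu]|[-> -> q_gt0]].
- by constructor 1; rewrite /conjg !hall_mulE !hall_invE /= addrCA addNr addr0.
- constructor 2; rewrite /conjg !hall_mulE !hall_invE /=.
  split; first by ring.
  rewrite shift0l shiftD addrCA addNr addr0; exact: lexpos_shift.
- constructor 3; rewrite -/(cen q) conjgE.
  by rewrite (cen_commute q (r, v, l)) mulKg.
Qed.

Lemma hall_posV x : x != 1 -> hall_pos x || hall_pos x^-1.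
Proof.
case: x => [[q u] k] x1; apply/orP; rewrite hall_invE /hall_pos /=.
have [k_lt0|k_gt0|k0] := ltgtP k 0%R.
- by right; rewrite oppr_gt0 k_lt0.
- by left.
rewrite {k}k0 oppr0 ltxx eqxx /= in x1 *.
have [u0|/lexposVN/orP[]] := eqVneq u 0%R; last 2 first.
- by move=> ->; left.
- by rewrite shift0l => ->; right.
rewrite {u}u0 shift0 oppr0 eqxx (negbTE lexpos0) /= beta0l sub0r oppr_gt0 in x1 *.
have [q_gt0|q_lt0|q0] := ltgtP 0%R q; [by left | by right |].
by rewrite -q0 eqxx in x1.
Qed.

Lemma hall_lt_full_order : full_order hall_lt.
Proof.
apply: full_order_cone.
- by rewrite /hall_pos /= !ltxx (negbTE lexpos0) !andbF.
- exact: hall_posM.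
- exact: hall_posJ.
- exact: hall_posV.
Qed.

(** * Generation by two elements *)

(** For positive [n] the second term is s(-n) = 0; at [n = 0] the two terms would cancel. *)
Lemma beta_delta_skew (n : nat) : (0 < n)%N ->
  (beta (delta 0) (delta n%:Z) - beta (delta n%:Z) (delta 0) = (n`!%:R)^-1)%R.
Proof. by case: n => // n _; rewrite !beta_delta -[invfact (0 - _)]/0%R !subr0. Qed.

Lemma hall_generated : generated [set vec (delta 0); tr 1%R] = setT.
Proof.
set H := generated _.
have subgH : is_subgroup H by apply: is_subgroup_generated.
have H1 := subgroup1 subgH.
have HM := subgroupM subgH; have HV := subgroupV subgH.
have Htr k : H (tr k).
  rewrite -[k]intz; apply: (@mulz_closed _ (fun k => H (tr k))) => //.
  - by move=> a b Ha Hb; rewrite trD; apply: HM.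
  - by move=> a Ha; rewrite trN; apply: HV.
  - by apply: sub_gen_smallest; right.
(* e_i is the conjugate of e_0 by a power of t. *)
have Hdelta i : H (vec (delta i)).
  rewrite -[i]add0r -shift_delta vec_shift.
  by apply: (HM _ _ (HM _ _ _ _)) => //; apply: sub_gen_smallest; left.
have Hcen q : H (cen q).
  have Hmulz a (n : int) : H (cen a) -> H (cen (a *~ n)%R).
    apply: (@mulz_closed _ (fun a => H (cen a))) => //.
    - by move=> c d Hc Hd; rewrite cenD; apply: HM.
    - by move=> c Hc; rewrite cenN; apply: HV.
  have Hfact (n : nat) : (0 < n)%N -> H (cen (n`!%:R)^-1%R).
    move=> n0; have := subgroupR subgH (Hdelta 0%R) (Hdelta n%:Z).
    by rewrite commg_ker //= beta_delta_skew.
  have [d [d_gt0 dq]] : exists d : nat, (0 < d)%N /\ denq q = d.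
    by exists `|denq q|%N; rewrite absz_gt0 denq_neq0 absz_denq.
  rewrite -[q]divq_num_den dq.
  (* The commutators [e_0, e_n] supply only 1/n!; a fraction a/d is the multiple of 1/d! by the
     integer a (d-1)!. *)
  have -> : ((numq q)%:~R / d%:~R = (d`!%:R)^-1 *~ (numq q * (d.-1)`!%:Z) :> rat)%R.
    rewrite -[RHS]mulrzr intrM -[d in d`!](prednK d_gt0) factS natrM prednK //.
    have d0 : (d%:R != 0 :> rat)%R by rewrite pnatr_eq0 -lt0n.
    have f0 : ((d.-1)`!%:R != 0 :> rat)%R by rewrite pnatr_eq0 -lt0n fact_gt0.
    by rewrite -!pmulrn; field; rewrite f0 d0.
  by apply: Hmulz; apply: Hfact.
(* This comes after [Hcen] because [vec] respects sums and opposites only up to a central factor. *)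
have Hvec u : H (vec u).
  have Hadd v w : H (vec v) -> H (vec w) -> H (vec (v + w)%R).
    by move=> Hv Hw; rewrite vecD; apply: (HM) => //; apply: HM.
  have Hopp v : H (vec v) -> H (vec (- v)%R).
    by move=> Hv; rewrite vecN; apply: HM => //; apply: HV.
  rewrite [u]lattice_sum; apply: (big_ind (fun u => H (vec u))) => // i _.
  exact: (@mulz_closed _ (fun u => H (vec u))).
apply/seteqP; split=> // -[[q u] k] _; rewrite hall_decomp.
by apply: (HM) => //; apply: HM.
Qed.

(** * Derived length *)

Lemma second_derived_neq1 :
  [~ [~ vec (delta 0), tr 1%R], [~ vec (delta 1), tr 1%R]] != 1.
Proof.
rewrite commg_ker ?commg_snd // !commg_vec_tr.
rewrite !(betaDl, betaDr, betaNl, betaNr) !beta_delta.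
(* The V-components are e_(-1) - e_0 and e_0 - e_1, so only values of s at explicit integers remain;
   the central component is 3/2. *)
by vm_compute.
Qed.

Lemma is_subgroup_cen : is_subgroup (range cen).
Proof.
apply/is_subgroupP; split=> [|_ _ [q _ <-] [r _ <-]]; first by exists 0%R.
by exists (q - r)%R => //; rewrite cenD cenN.
Qed.

Lemma hall_derived_length : solvable_of_length hall 3.
Proof.
have subg1 : is_subgroup [set 1 : hall].
  by apply/is_subgroupP; split=> // x y -> ->; rewrite mulgV.
split.
  have subg_tr : is_subgroup [set x : hall | x.2 = 0%R].
    by apply/is_subgroupP; split=> // x y x2 y2; rewrite /= x2 y2 subr0.
  have D1 : derived_subgroup hall 1 `<=` [set x | x.2 = 0%R].
    by apply: commutator_subgroup_sub => // x y _ _; apply: commg_snd.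
  have D2 : derived_subgroup hall 2 `<=` range cen.
    apply: commutator_subgroup_sub is_subgroup_cen _ => x y /D1 x2 /D1 y2.
    by rewrite commg_ker //; eexists.
  apply/seteqP; split=> [|_ ->]; last exact: subgroup1 (is_subgroup_generated _).
  apply: commutator_subgroup_sub => // _ _ /D2[q _ <-] /D2[r _ <-].
  by apply: commg_eq; rewrite mulg1 cen_commute.
have := second_derived_neq1.
set x := [~ vec (delta 0), _]; set y := [~ vec (delta 1), _] => xy.
have D1x : derived_subgroup hall 1 x by apply: mem_commutator.
have D1y : derived_subgroup hall 1 y by apply: mem_commutator.
have D2xy : derived_subgroup hall 2 [~ x, y] by apply: mem_commutator.
(* The derived subgroups of index 0, 1 and 2 contain the nontrivial elements [x], [x] and [[~ x, y]]
   respectively. *)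
have x1 : x != 1 by apply: contraNneq xy => ->; rewrite -commg1_sym commg1.
case=> [|[|[|//]]] _ Dm.
- by move/eqP: x1; apply; suff: derived_subgroup hall 0 x by rewrite Dm.
- by move/eqP: x1; apply; move: D1x; rewrite Dm.
- by move/eqP: xy; apply; move: D2xy; rewrite Dm.
Qed.

(** * Subnormality of Q and the conclusion *)

(** A series of length one suffices, since a central subgroup is normal. *)
Lemma cen_subnormal : is_subnormal (range cen).
Proof.
exists 1%N, (fun i => if i is 0%N then range cen else setT); split=> //.
  by case=> [|i] _; [exact: is_subgroup_cen | apply/is_subgroupP].
case=> // _; split=> // _ k [q _ <-] _; exists q => //.
by rewrite conjgE cen_commute mulKg.
Qed.

Local Close Scope group_scope.
Local Close Scope classical_set_scope.
Local Close Scope ring_scope.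

Theorem theorem1 :
  exists (G : groupType) (lt : rel G) (Phi : rat -> G),
    [/\ two_generator G,
        full_order lt,
        [/\ {morph Phi : x y / (x + y)%R >-> (x * y)%g},
            injective Phi,
            {mono Phi : x y / (x < y)%R >-> lt x y}
          & is_subnormal (range Phi)]
      & solvable_of_length G 3].
Proof.
exists hall, hall_lt, cen; split.
- by exists (vec (delta 0)), (tr 1%R); exact: hall_generated.
- exact: hall_lt_full_order.
- split; [exact: cenD | by move=> q r [] | | exact: cen_subnormal].
  (* The quotient of the two images is the central element of [r - q], so only the last level of the
     lexicographic order decides. *)
  move=> q r; rewrite /hall_lt -cenN -cenD /hall_pos /= (negbTE lexpos0) eqxx /=.
  by rewrite addrC subr_gt0.
- exact: hall_derived_length.
Qed.
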